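(* Let $X$ be a real Banach space, $T$ a nonempty index set, $(a_t^*,b_t)\in X^*\times\mathbb{R}$ ($t\in T$) an arbitrary family, $\mathcal{J}=\{T_j\mid j\in J\}$ an arbitrary partition of $T$ into nonempty blocks, and let $\mathcal{F}_{\mathcal{J}}$, $\mathcal{F}_{\min}$, $\mathcal{F}_{\max}$ be the associated feasible solution maps and $C(0)=\mathrm{co}\{(a_t^*,b_t)\mid t\in T\}$. For any $\overline{x}\in\mathcal{F}_{\mathcal{J}}(0)$ we have \begin{align*} \sup\Big\{\|u^*\|^{-1}\;\Big|\;\big(u^*,\langle u^*,\overline{x}\rangle\big)\in \mathrm{cl}^*C(0)\Big\}&\le \|D^*\mathcal{F}_{\min}(0,\overline{x})\|\le\|D^*\mathcal{F}_{\mathcal{J}}(0,\overline{x})\|\\ &\le \mathrm{lip}\,\mathcal{F}_{\mathcal{J}}(0,\overline{x})\le\mathrm{lip}\,\mathcal{F}_{\max}(0,\overline{x}). \end{align*} Furthermore, if either the coefficient set $\{a_t^*\mid t\in T\}$ is bounded in $X^*$ or the space $X$ is reflexive, then \begin{align*} \sup\Big\{\|u^*\|^{-1}\;\Big|\;\big(u^*,\langle u^*,\overline{x}\rangle\big)\in \mathrm{cl}^*C(0)\Big\}&= \|D^*\mathcal{F}_{\min}(0,\overline{x})\|=\|D^*\mathcal{F}_{\mathcal{J}}(0,\overline{x})\|\\ &= \mathrm{lip}\,\mathcal{F}_{\mathcal{J}}(0,\overline{x})=\mathrm{lip}\,\mathcal{F}_{\max}(0,\overline{x}). \end{align*}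
   Context: Block-perturbed systems. $l_\infty(J)$ is the Banach space of bounded functions $p=(p_j)_{j\in J}$ with norm $\|p\|=\sup_{j\in J}|p_j|$. For a partition $\mathcal{J}=\{T_j\mid j\in J\}$ of $T$ (nonempty pairwise disjoint sets with union $T$), the map $\mathcal{F}_{\mathcal{J}}:l_\infty(J)\rightrightarrows X$ is $$\mathcal{F}_{\mathcal{J}}(p):=\{x\in X\mid \langle a_t^*,x\rangle\le b_t+p_j\ \text{ for all } t\in T_j,\ j\in J\}.$$ The extreme partitions are $\mathcal{J}_{\min}=\{T\}$ and $\mathcal{J}_{\max}=\{\{t\}\mid t\in T\}$; the corresponding maps are $\mathcal{F}_{\min}:\mathbb{R}\rightrightarrows X$ and $\mathcal{F}_{\max}:l_\infty(T)\rightrightarrows X$. The set $\mathcal{F}_{\mathcal{J}}(0)$ is the same for all partitions. Notation. $\mathrm{co}$ is the convex hull; $\mathrm{cl}^*$ is the weak$^*$ closure (here in $X^*\times\mathbb{R}$, dual of $X\times\mathbb{R}$); norms on dual spaces are the dual norms. Conventions: $\sup\varnothing:=0$ and $0^{-1}:=\infty$ (so the first supremum is $\infty$ if $(0,0)\in\mathrm{cl}^*C(0)$). Exact Lipschitzian bound. A set-valued map $F:Z\rightrightarrows Y$ between Banach spaces is Lipschitz-like around $(\bar z,\bar y)\in\mathrm{gph}\,F$ with modulus $\ell\ge0$ if there are neighborhoods $U$ of $\bar z$ and $V$ of $\bar y$ with $F(z)\cap V\subset F(u)+\ell\|z-u\|\mathbb{B}_Y$ for all $z,u\in U$, where $\mathbb{B}_Y$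 is the closed unit ball. $\mathrm{lip}\,F(\bar z,\bar y)\in[0,\infty]$ is the infimum of all such moduli $\ell$ over all possible $(\ell,U,V)$, and equals $\infty$ if $F$ is not Lipschitz-like around $(\bar z,\bar y)$. Coderivative. $D^*F(\bar z,\bar y)(y^* ):=\{z^*\in Z^*\mid (z^*,-y^* )\in N((\bar z,\bar y);\mathrm{gph}\,F)\}$ for $y^*\in Y^*$, where $N$ is the basic (limiting, Mordukhovich) normal cone; for the maps considered here the graph is convex, and then $N(w;\Omega)=\{w^*\mid \langle w^*,v-w\rangle\le 0\ \forall v\in\Omega\}$ is the normal cone of convex analysis. The coderivative norm is $\|D^*F(\bar z,\bar y)\|:=\sup\{\|z^*\|\mid z^*\in D^*F(\bar z,\bar y)(y^* ),\ \|y^*\|\le1\}\in[0,\infty]$. *)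

(* Defs.v *)
From HB Require Import structures.
From mathcomp Require Import all_boot all_order all_algebra.
From mathcomp Require Import all_classical all_reals all_analysis.

Set Implicit Arguments.
Unset Strict Implicit.
Unset Printing Implicit Defensive.

Import Order.TTheory GRing.Theory Num.Theory.
Import numFieldNormedType.Exports.

Local Open Scope classical_set_scope.
Local Open Scope ring_scope.

(* topological dual of [X], normed below by the dual norm *)
Definition dual_pred (R : realType) (X : normedModType R) : {pred X -> R^o} :=
  fun f => `[< linear f /\ continuous f >].

Record dual (R : realType) (X : normedModType R) := Dual {
  dual_fun :> X -> R^o;
  dualP : dual_fun \in @dual_pred R X }.

Section Dual.
Context {R : realType} {X : normedModType R}.

Lemma dual_submod_closed : submod_closed (@dual_pred R X).
Proof.
split=> [|c f g /asboolP[lf cf] /asboolP[lg cg]]; apply/asboolP.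
  split=> [k u v|]; last exact: cst_continuous.
  by rewrite -[LHS]/(0 : R^o) -[RHS]/(k *: (0 : R^o) + 0) scaler0 addr0.
split=> [k u v|x].
  rewrite !fctE lf lg !scalerDr !scalerA [c * k]mulrC !addrA; congr (_ + _).
  by rewrite addrAC.
by apply: cvgD; [apply: cvgZl_tmp; exact: cf | exact: cg].
Qed.

HB.instance Definition _ :=
  GRing.isSubmodClosed.Build R (X -> R^o) (@dual_pred R X) dual_submod_closed.

HB.instance Definition _ := [isSub for @dual_fun R X].
HB.instance Definition _ := [Choice of dual X by <:].
HB.instance Definition _ := [SubChoice_isSubLmodule of dual X by <:].

Implicit Types f g : dual X.

Lemma dual_linear f : linear f.
Proof. by have /asboolP[] := dualP f. Qed.

Lemma dual_continuous f : continuous f.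
Proof. by have /asboolP[] := dualP f. Qed.

HB.instance Definition _ f :=
  GRing.isLinear.Build R X R^o *:%R f (dual_linear f).

Definition dual_norm f : R := sup [set `|f x| | x in [set x | `|x| <= 1]].

Lemma dual_has_sup f : has_sup [set `|f x| | x in [set x : X | `|x| <= 1]].
Proof.
split; first by exists `|f 0|, 0 => //=; rewrite normr0 ler01.
have /linear_bounded_continuous/bounded_funP/(_ 1)[M fM] := @dual_continuous f.
by exists M => _ [x x1 <-]; exact: fM.
Qed.

Lemma dual_norm_ub f x : `|f x| <= dual_norm f * `|x|.
Proof.
have [->|x0] := eqVneq x 0; first by rewrite linear0 !normr0 mulr0.
rewrite -ler_pdivrMr ?normr_gt0//.
apply: (sup_upper_bound (dual_has_sup f)); exists (`|x|^-1 *: x).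
  by rewrite /= normrZ normfV normr_id mulVf// normr_eq0.
by rewrite linearZ normrM normfV normr_id mulrC.
Qed.

Let dual_norm_le f M : (forall x, `|x| <= 1 -> `|f x| <= M) -> dual_norm f <= M.
Proof.
move=> fM; apply: ge_sup; first by case: (dual_has_sup f).
by move=> _ [x x1 <-]; exact: fM.
Qed.

Let dual_norm_ge0 f : 0 <= dual_norm f.
Proof.
apply: (sup_upper_bound (dual_has_sup f)).
by exists 0; rewrite /= ?linear0 normr0.
Qed.

Let dual_normD f g : dual_norm (f + g) <= dual_norm f + dual_norm g.
Proof.
apply: dual_norm_le => x x1; rewrite (le_trans (ler_normD _ _))// lerD//.
  by rewrite (le_trans (dual_norm_ub _ _))// ler_piMr.
by rewrite (le_trans (dual_norm_ub _ _))// ler_piMr.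
Qed.

Let dual_normZle (c : R) f : dual_norm (c *: f) <= `|c| * dual_norm f.
Proof.
apply: dual_norm_le => x x1; rewrite [leLHS]normrM ler_wpM2l//.
by rewrite (le_trans (dual_norm_ub _ _))// ler_piMr.
Qed.

Let dual_normZ (c : R) f : dual_norm (c *: f) = `|c| * dual_norm f.
Proof.
apply/eqP; rewrite eq_le dual_normZle /=.
have [->|c0] := eqVneq c 0; first by rewrite normr0 mul0r.
rewrite -ler_pdivlMl ?normr_gt0// -normfV.
by rewrite (le_trans _ (dual_normZle _ _))// scalerA mulVf// scale1r.
Qed.

Let dual_norm0_eq0 f : dual_norm f = 0 -> f = 0.
Proof.
move=> f0; apply/val_inj/funext => x /=; apply/eqP; rewrite -normr_le0.
by rewrite (le_trans (dual_norm_ub _ _))// f0 mul0r.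
Qed.

HB.instance Definition _ := Lmodule_isNormed.Build R (dual X)
  dual_normD dual_normZ dual_norm0_eq0.

Lemma dual_normE f : `|f| = sup [set `|f x| | x in [set x | `|x| <= 1]].
Proof. by []. Qed.

End Dual.

(* Banach space of bounded functions [J -> R], [J] an arbitrary type *)
Definition linfty_pred (R : realType) (J : Type) : {pred J -> R^o} :=
  fun p => `[< exists M, forall j, `|p j| <= M >].

Record linfty (R : realType) (J : Type) := Linfty {
  linfty_fun :> J -> R^o;
  linftyP : linfty_fun \in @linfty_pred R J }.

Section Linfty.
Context {R : realType} {J : Type}.

Lemma linfty_submod_closed : submod_closed (@linfty_pred R J).
Proof.
split=> [|c f g /asboolP[M fM] /asboolP[N gN]]; apply/asboolP.
  by exists 0 => j; rewrite -[X in `|X|]/(0 : R^o) normr0.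
exists (`|c| * M + N) => j.
by rewrite (le_trans (ler_normD _ _))// lerD// normrM ler_wpM2l.
Qed.

HB.instance Definition _ :=
  GRing.isSubmodClosed.Build R (J -> R^o) (@linfty_pred R J)
    linfty_submod_closed.

HB.instance Definition _ := [isSub for @linfty_fun R J].
HB.instance Definition _ := [Choice of linfty R J by <:].
HB.instance Definition _ := [SubChoice_isSubLmodule of linfty R J by <:].

Implicit Types p q : linfty R J.

Definition linfty_norm p : R := sup (range (fun j => `|p j|)).

Lemma linfty_norm_ub p j : `|p j| <= linfty_norm p.
Proof.
apply: ub_le_sup; last by exists j.
have /asboolP[M pM] := linftyP p.
by exists M => _ [i _ <-].
Qed.

Let linfty_norm_le p M : 0 <= M -> (forall j, `|p j| <= M) -> linfty_norm p <= M.
Proof.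
move=> M0 pM; rewrite /linfty_norm.
have [->|J0] := eqVneq (range (fun j => `|p j|)) set0; first by rewrite sup0.
by apply: ge_sup; [exact/set0P | move=> _ [j _ <-]].
Qed.

Let linfty_norm_ge0 p : 0 <= linfty_norm p.
Proof.
have [J0|/set0P[_ [j _ _]]] := eqVneq (range (fun j => `|p j|)) set0.
  by rewrite /linfty_norm J0 sup0.
exact: le_trans (linfty_norm_ub p j).
Qed.

Let linfty_normD p q : linfty_norm (p + q) <= linfty_norm p + linfty_norm q.
Proof.
apply: linfty_norm_le => [|j]; first exact: addr_ge0.
by rewrite (le_trans (ler_normD _ _))// lerD// linfty_norm_ub.
Qed.

Let linfty_normZle (c : R) p : linfty_norm (c *: p) <= `|c| * linfty_norm p.
Proof.
apply: linfty_norm_le => [|j]; first exact: mulr_ge0.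
by rewrite [leLHS]normrM ler_wpM2l// linfty_norm_ub.
Qed.

Let linfty_normZ (c : R) p : linfty_norm (c *: p) = `|c| * linfty_norm p.
Proof.
apply/eqP; rewrite eq_le linfty_normZle /=.
have [->|c0] := eqVneq c 0; first by rewrite normr0 mul0r.
rewrite -ler_pdivlMl ?normr_gt0// -normfV.
by rewrite (le_trans _ (linfty_normZle _ _))// scalerA mulVf// scale1r.
Qed.

Let linfty_norm0_eq0 p : linfty_norm p = 0 -> p = 0.
Proof.
move=> p0; apply/val_inj/funext => j /=; apply/eqP; rewrite -normr_le0.
by rewrite (le_trans (linfty_norm_ub _ _))// p0.
Qed.

HB.instance Definition _ := Lmodule_isNormed.Build R (linfty R J)
  linfty_normD linfty_normZ linfty_norm0_eq0.

Lemma linfty_normE p : `|p| = sup (range (fun j => `|p j|)).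
Proof. by []. Qed.

Lemma linfty_cauchy_cvg (F : set_system (linfty R J)) :
  ProperFilter F -> cauchy F -> cvg F.
Proof.
move=> FF /cauchyP Fc.
have Fe (e : R) : 0 < e -> exists p : linfty R J, F [set q | `|p - q| < e].
  by move=> e0; have [p Fp] := Fc e e0; exists p; move: Fp; rewrite -ball_normE.
have evB p q j : `|p j - q j| <= `|p - q| by exact: (linfty_norm_ub (p - q)).
pose ev j (p : linfty R J) : R^o := p j.
have evc j : cvg (ev j @ F).
  apply: cauchy_cvg; apply/cauchyP => e e0.
  have [p Fp] := Fe e e0; exists (p j).
  suff : F [set q | ball (p j : R^o) e (q j)] by [].
  apply: filterS Fp => q pq.
  by rewrite -ball_normE /=; exact: le_lt_trans (evB p q j) pq.
pose l : J -> R^o := fun j => lim (ev j @ F).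
have lP (e : R) p : F [set q | `|p - q| < e] -> forall j, `|p j - l j| <= e.
  move=> Fp j; apply/ler_addgt0Pr => d d0.
  have /cvgrPdist_lt/(_ d d0) ld : ev j @ F --> l j by exact: evc.
  have [q [/= pq ldq]] := filter_ex (filterI Fp ld).
  rewrite -(subrKA (q j)) (le_trans (ler_normD _ _))// lerD//.
    by rewrite (le_trans (evB _ _ _))// ltW.
  by rewrite distrC ltW.
have lb : l \in @linfty_pred R J.
  apply/asboolP; have [p Fp] := Fe 1 ltr01; exists (`|p| + 1) => j.
  rewrite -(subKr (p j) (l j)) (le_trans (ler_normB _ _))// lerD//.
    exact: linfty_norm_ub.
  exact: lP.
apply/cvg_ex; exists (Linfty lb); apply/cvgrPdist_le => e e0.
have e20 : 0 < e / 2 by rewrite divr_gt0.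
have [p Fp] := Fe _ e20; apply: filterS (Fp) => q /= pq.
rewrite -(subrKA p) (splitr e) (le_trans (ler_normD _ _))// lerD ?(ltW pq)//.
apply: linfty_norm_le => [|j]; first exact: ltW.
by rewrite distrC; exact: lP.
Qed.

HB.instance Definition _ :=
  Uniform_isComplete.Build (linfty R J) linfty_cauchy_cvg.

End Linfty.

(* [dual X] with the topology of pointwise convergence on [X] instead of the
   norm topology *)
Definition weak_star (R : realType) (X : normedModType R) : Type :=
  initial_topology (fun f : dual X => dual_fun f : {ptws X -> R^o}).

HB.instance Definition _ (R : realType) (X : normedModType R) :=
  Topological.on (@weak_star R X).

Lemma weak_star_cvgP (R : realType) (X : normedModType R)
    (F : set_system (dual X)) (f : dual X) : Filter F ->
  F --> (f : weak_star X) <-> forall x, g x @[g --> F] --> f x.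
Proof.
move=> FF; pose ev (g : dual X) : {ptws X -> R^o} := dual_fun g.
suff -> : (F --> (f : weak_star X)) = (ev @ F --> ev f) by exact: pointwise_cvgP.
apply/propext; split=> [Ff A /(@initial_continuous _ _ ev f)|Ff A].
  exact: Ff.
rewrite nbhsE => -[_ [[C oC <-] Cf] CA].
by apply: filterS CA _; apply: Ff; exact: open_nbhs_nbhs.
Qed.

(* The dual of [X * R] is identified with [dual X * R], whose weak* topology is
   the product of the weak* topology of [dual X] and the usual one of [R]. *)
Definition weak_star_closure (R : realType) (X : normedModType R)
    (A : set (dual X * R^o)) : set (dual X * R^o) :=
  closure (A : set (weak_star X * R^o)).

Definition reflexive_space (R : realType) (X : normedModType R) : Prop :=
  forall F : dual (dual X), exists x : X, forall f : dual X, F f = f x.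

Definition conv_hull (R : realType) (V : lmodType R) (A : set V) : set V :=
  [set v | exists n (l : 'I_n -> R) (w : 'I_n -> V),
    [/\ forall i, 0 <= l i, \sum_i l i = 1, forall i, A (w i)
      & v = \sum_i l i *: w i]].

Section DualPair.
Context {R : realType} {Z Y : normedModType R}.

(* the identification of [dual Z * dual Y] with the dual of [Z * Y] *)
Definition dual_pair_fun (f : dual Z) (g : dual Y) : Z * Y -> R^o :=
  fun zy => f zy.1 + g zy.2.

Lemma dual_pairP f g : dual_pair_fun f g \in @dual_pred R (Z * Y)%type.
Proof.
apply/asboolP; split=> [k u v|u].
  by rewrite /dual_pair_fun /= !linearP scalerDr addrACA.
apply: cvgD.
- apply: continuous_comp; [exact: cvg_fst | exact: dual_continuous].
- apply: continuous_comp; [exact: cvg_snd | exact: dual_continuous].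
Qed.

Definition dual_pair f g : dual (Z * Y)%type := Dual (dual_pairP f g).

End DualPair.

Section Normals.
Context {R : realType}.

(* epsilon-normals: the limsup of the quotients <f, v - w> / |v - w| as [v]
   tends to [w] in [O], [v != w]; it is -oo at an isolated point of [O]. *)
Definition eps_normal (W : normedModType R) (O : set W) (e : R) (w : W) :
    set (dual W) :=
  [set f | O w /\
    (limf_esup (fun v => (f (v - w) / `|v - w|)%:E) (within O w^') <= e%:E)%E].

(* Basic (limiting, Mordukhovich) normal cone in an arbitrary normed space: the
   sequential upper limit, for the norm of [W] and the weak* topology of its
   dual, of the sets of epsilon-normals as epsilon tends to 0. *)
Definition limiting_normal (W : normedModType R) (O : set W) (w : W) :
    set (dual W) :=
  [set f | O w /\ exists (e : nat -> R) (ws : nat -> W) (fs : nat -> dual W),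
    [/\ (forall k, 0 <= e k) /\ e @ \oo --> 0,
        ws @ \oo --> w,
        (fs : nat -> weak_star W) @ \oo --> (f : weak_star W)
      & forall k, eps_normal O (e k) (ws k) (fs k)]].

Context {Z Y : normedModType R}.
Implicit Types F : Z -> set Y.

Definition graph F : set (Z * Y) := [set zy | F zy.1 zy.2].

Definition coderivative F (z : Z) (y : Y) (g : dual Y) : set (dual Z) :=
  [set f | limiting_normal (graph F) (z, y) (dual_pair f (- g))].

(* convention sup set0 = 0, whereas [ereal_sup set0] is -oo *)
Definition sup_or_0 (A : set (\bar R)) : \bar R :=
  if A == set0 then 0%E else ereal_sup A.

Definition coderivative_norm F z y : \bar R :=
  sup_or_0 [set `|f|%:E | f in \bigcup_(g in [set g | `|g| <= 1])
                             coderivative F z y g].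

Definition lipschitz_like F (z : Z) (y : Y) (l : R) : Prop :=
  exists U V, [/\ nbhs z U, nbhs y V &
    forall z1 u, U z1 -> U u -> F z1 `&` V `<=`
      [set v + (l * `|z1 - u|) *: b | v in F u & b in [set b | `|b| <= 1]]].

(* +oo if there is no modulus, as [ereal_inf set0] is +oo *)
Definition lip F z y : \bar R :=
  ereal_inf [set l%:E | l in [set l | 0 <= l /\ lipschitz_like F z y l]].

End Normals.
Arguments coderivative_norm {R Z Y} F (z y)%_R.
Arguments lip {R Z Y} F (z y)%_R.

Section System.
Context {R : realType} {X : normedModType R} {T : Type}.
Variables (a : T -> dual X) (b : T -> R).

Definition feasible (J : Type) (D : J -> set T) (p : linfty R J) : set X :=
  [set x | forall j t, D j t -> a t x <= b t + p j].

(* feasible maps of the partitions {T} and {{t} | t in T} *)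
Definition feasible_min (p : R^o) : set X :=
  [set x | forall t, a t x <= b t + p].

Definition feasible_max : linfty R T -> set X := feasible (fun t => [set t]).

Definition C0 : set (dual X * R^o) := conv_hull (range (fun t => (a t, b t))).

(* [0^-1] is +oo in [\bar R] *)
Definition slope_sup (x : X) : \bar R :=
  sup_or_0 [set ((`|u|%:E)^-1)%E
       | u in [set u : dual X | weak_star_closure C0 (u, u x)]].

End System.

(* Main.v *)
Require Import Defs.
From HB Require Import structures.
From mathcomp Require Import all_boot all_order all_algebra.
From mathcomp Require Import all_classical all_reals all_analysis.
From mathcomp Require Import lra ring.

Set Implicit Arguments.
Unset Strict Implicit.
Unset Printing Implicit Defensive.

Import Order.TTheory GRing.Theory Num.Theory.
Import numFieldNormedType.Exports.

Local Open Scope classical_set_scope.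
Local Open Scope ring_scope.

(** Write S for the supremum of the reciprocals 1/|u| over the pairs
    (u, u xbar) in the weak* closure of C(0).  The proof establishes the four
    inequalities of the chain
      S <= |D*F_min| <= |D*F_J| <= lip F_J <= lip F_max
    and closes it into a cycle by lip F_max <= S ([lip_max_le_slope_sup]), so
    that all five quantities coincide.

    The graphs are convex, so limiting normals to them are ordinary normals of
    convex analysis ([limiting_normal_convex]).

    - S <= |D*F_min|: for (u, u xbar) in the closure, the inequality
      u (x - xbar) <= p survives on the graph of F_min because it is a closed
      condition on (u, u xbar).  It says that (-1, u) is normal to the graph.

    - |D*F_min| <= |D*F_J|: a normal (-mu, -g) to the graph of F_min has to be
      lifted to a normal (h, -g) to the graph of F_J, with |h| >= mu.  Minus h
      must lie above the concave function sending p to the supremum of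
      -g (x - xbar) over F_J(p), and below the sublinear function mu * sup p,
      which forces its value at the constant function 1 to be mu.  The
      Hahn-Banach sandwich theorem provides it ([coderivative_norm_min_le]).

    - |D*F_J| <= lip F_J holds for every map with a convex graph
      ([coderivative_norm_le_lip]), and lip F_J <= lip F_max holds because F_J
      is F_max composed with the 1-Lipschitz map that repeats p_j along the
      block T_j ([lip_block_le]).

    - lip F_max <= S: suppose that l > 0 is not a Lipschitz modulus.  Then
      arbitrarily close to (0, xbar) there are p, u and x in F_max(p) with no
      point of F_max(u) within l |p - u| of x.  Against finitely many test
      vectors y_i of the unit ball, the sandwich theorem in R^m turns this
      emptiness into a convex combination (v, alpha) of the (a_t, b_t + u_t)
      with l |p - u| |v y_i| < v x - alpha
      ([infeasibility_certificate]).  As v x - alpha <= |p - u|, this gives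
      |v y_i| <= 1/l, while alpha is close to v xbar.  A limit of these
      certificates along an ultrafilter, as the test vectors increase and
      (p, u, x) tends to (0, 0, xbar), is a functional v of norm at most 1/l
      with (v, v xbar) in the weak* closure of C(0)
      ([weak_star_cluster]).  Hence S >= l.  Testing against finite families
      keeps every duality step in finite dimension, where every functional is
      an evaluation; only the limit needs compactness. *)

(** * Sublinear functions and the Hahn-Banach sandwich theorem *)

(** Subadditive and positively homogeneous; the inequality for all c > 0 gives
    the equality, by applying it to 1/c. *)
Definition sublinear (R : realType) (E : lmodType R) (q : E -> R) : Prop :=
  (forall x y, q (x + y) <= q x + q y) /\
  (forall (c : R) x, 0 < c -> q (c *: x) <= c * q x).

(** Linearity of a function as it comes out of Zorn's lemma, before it is known
    to be continuous and can be made an element of the dual. *)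
Definition real_linear (R : realType) (E : lmodType R) (phi : E -> R) : Prop :=
  forall (c : R) x y, phi (c *: x + y) = c * phi x + phi y.

Section HahnBanach.
Context {R : realType} {E : lmodType R}.
Implicit Types (q p phi : E -> R) (S : set (E * R)).

Lemma real_linear0 phi : real_linear phi -> phi 0 = 0.
Proof. by move=> /(_ (-1) 0 0); rewrite scaler0 addr0 mulN1r addNr. Qed.

Lemma real_linearN phi x : real_linear phi -> phi (- x) = - phi x.
Proof.
move=> lphi; have := lphi (-1) x 0.
by rewrite (real_linear0 lphi) !addr0 scaleN1r mulN1r.
Qed.

Lemma sublinear0 q : sublinear q -> q 0 = 0.
Proof.
move=> [qD qZ]; have := qD 0 0.
have : 0 < 2^-1 :> R by rewrite invr_gt0.
by move=> /(qZ _ 0); rewrite scaler0 addr0; lra.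
Qed.

Lemma sublinear_opp_le q x : sublinear q -> - q (- x) <= q x.
Proof.
move=> sq; have := sq.1 x (- x); rewrite subrr (sublinear0 sq); lra.
Qed.

Lemma sublinearZ q (c : R) x : sublinear q -> 0 <= c -> q (c *: x) = c * q x.
Proof.
move=> sq; rewrite le_eqVlt => /predU1P[<-|c0].
  by rewrite scale0r mul0r sublinear0.
apply/eqP; rewrite eq_le sq.2//= -ler_pdivlMl//.
by rewrite -[x in q x <= _](scalerK (lt0r_neq0 c0)) sq.2// invr_gt0.
Qed.

(** A pair (x, s) in S is a constraint s <= phi x on an unknown linear function
    phi: such constraints can be added and rescaled. *)
Definition convex_cone S : Prop :=
  [/\ S (0, 0), (forall u v, S u -> S v -> S (u.1 + v.1, u.2 + v.2)) &
      forall (c : R) u, 0 < c -> S u -> S (c *: u.1, c * u.2)].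

(** The largest sublinear function below q that already takes the constraints
    of S into account, in the sense that its value at -x is at most -s for every
    (x, s) in S.  Any linear function below it therefore satisfies all of S. *)
Definition lower_env q S (x : E) : R :=
  inf [set q (x + u.1) - u.2 | u in S].

Section LowerEnv.
Variables (q : E -> R) (S : set (E * R)).
Hypotheses (sq : sublinear q) (cS : convex_cone S).
Hypothesis Sq : forall u, S u -> u.2 <= q u.1.

Let lb x : has_lbound [set q (x + u.1) - u.2 | u in S].
Proof.
exists (- q (- x)) => _ [u Su <-].
have := sq.1 (- x) (x + u.1); rewrite addKr; have := Sq Su; lra.
Qed.

Lemma lower_env_le x u : S u -> lower_env q S x <= q (x + u.1) - u.2.
Proof. by move=> Su; apply: ge_inf => //; exists u. Qed.

Let lower_env_ge x M : (forall u, S u -> M <= q (x + u.1) - u.2) ->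
  M <= lower_env q S x.
Proof.
move=> SM; apply: lb_le_inf; last by move=> _ [u Su <-]; exact: SM.
by case: cS => S0 _ _; exists (q (x + 0) - 0); exists (0, 0).
Qed.

Lemma lower_env_sublinear : sublinear (lower_env q S).
Proof.
have [S0 SD SZ] := cS.
split=> [x y|c x c0].
  rewrite -lerBlDr; apply: lower_env_ge => u Su.
  rewrite lerBlDr -lerBlDl; apply: lower_env_ge => v Sv.
  rewrite lerBlDl; have /= := lower_env_le (x + y) (SD _ _ Su Sv).
  have := sq.1 (x + u.1) (y + v.1); rewrite addrACA; lra.
rewrite -ler_pdivrMl//; apply: lower_env_ge => u Su.
rewrite ler_pdivrMl// mulrBr -(sublinearZ _ sq (ltW c0)) scalerDr.
exact: (lower_env_le _ (SZ _ _ c0 Su)).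
Qed.

Lemma lower_env_le_self x : lower_env q S x <= q x.
Proof.
by case: cS => S0 _ _; have /= := lower_env_le x S0; rewrite addr0 subr0.
Qed.

Lemma lower_env_opp u : S u -> lower_env q S (- u.1) <= - u.2.
Proof.
by move=> /(lower_env_le (- u.1)); rewrite addNr (sublinear0 sq) add0r.
Qed.

End LowerEnv.

(** Imposing the constraint p a <= phi a (which p itself meets with equality)
    by a lower envelope cannot change a minimal p, and the envelope is at most
    p (x + a) - p a: this is the missing half of additivity. *)
Lemma minimal_sublinear_linear p : sublinear p ->
  (forall p', sublinear p' -> (forall x, p' x <= p x) -> p' = p) ->
  real_linear p.
Proof.
move=> sp pmin.
have pD a x : p (x + a) = p x + p a.
  pose S := [set u : E * R | exists2 c : R, 0 <= c & u = (c *: a, c * p a)].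
  have cS : convex_cone S.
    split=> [|_ _ [c c0 ->] [d d0 ->]|k _ k0 [c c0 ->]] /=.
    - by exists 0 => //; rewrite scale0r mul0r.
    - by exists (c + d); [exact: addr_ge0 | rewrite scalerDl mulrDl].
    - by exists (k * c); [rewrite mulr_ge0// ltW | rewrite scalerA mulrA].
  have Sp u : S u -> u.2 <= p u.1.
    by move=> [c c0 ->]/=; rewrite sublinearZ.
  have Ep := pmin _ (lower_env_sublinear sp cS Sp)
                    (lower_env_le_self sp cS Sp).
  apply/eqP; rewrite eq_le sp.1/= -lerBrDr -{1}Ep.
  by apply: (@lower_env_le _ _ sp Sp x (a, p a)); exists 1; rewrite ?scale1r ?mul1r.
have pN x : p (- x) = - p x.
  by apply/eqP; rewrite -addr_eq0 -pD addNr (sublinear0 sp).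
move=> c x y; rewrite pD; congr (_ + _).
have [c0|c0] := leP 0 c; first exact: sublinearZ.
rewrite -[c]opprK scaleNr pN sublinearZ// ?oppr_ge0 ?(ltW c0)//; ring.
Qed.

(** Pointwise infima of chains of sublinear functions are sublinear, so Zorn's
    lemma gives a minimal sublinear function below q, which is linear. *)
Theorem hahn_banach q : sublinear q ->
  exists phi : E -> R, real_linear phi /\ forall x, phi x <= q x.
Proof.
move=> sq; pose A := {p : E -> R | sublinear p /\ forall x, p x <= q x}.
pose f (p : A) : E -> R := sval p.
pose le (p1 p2 : A) : bool := `[< forall x, f p2 x <= f p1 x >].
have [|r s t /asboolP rs /asboolP st|s t /asboolP st /asboolP ts|C Ctot|p pmin] :=
  @Zorn A le.
- by move=> p; apply/asboolP.
- by apply/asboolP => x; exact: le_trans (rs x).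
- case: s t st ts => [s Hs] [t Ht] /= st ts.
  apply: eq_exist; apply/funext => x; apply/eqP.
  by rewrite eq_le ts st.
- have [->|/set0P[p0 Cp0]] := eqVneq C set0.
    by exists (exist _ q (conj sq (fun x => lexx (q x)))).
  (* the members of the chain are bounded below at x by - q (- x) *)
  pose V x := [set f p x | p in C].
  have Vlb x : has_lbound (V x).
    exists (- q (- x)) => _ [p Cp <-].
    have [sp pq] := svalP p.
    by apply: le_trans (sublinear_opp_le x sp); rewrite lerN2.
  have V0 x : V x !=set0 by exists (f p0 x), p0.
  pose g x := inf (V x).
  have gle (p : A) x : C p -> g x <= f p x by move=> Cp; apply: ge_inf => //; exists p.
  have sg : sublinear g.
    split=> [x y|c x c0].
      rewrite -lerBlDr; apply: lb_le_inf => // _ [p1 Cp1 <-].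
      rewrite lerBlDr -lerBlDl; apply: lb_le_inf => // _ [p2 Cp2 <-].
      rewrite lerBlDl.
      have [/asboolP p12|/asboolP p21] := Ctot _ _ Cp1 Cp2.
        rewrite (le_trans (gle _ _ Cp2))// (le_trans ((svalP p2).1.1 _ _))//.
        by rewrite lerD2r; exact: p12.
      rewrite (le_trans (gle _ _ Cp1))// (le_trans ((svalP p1).1.1 _ _))//.
      by rewrite lerD2l; exact: p21.
    rewrite -ler_pdivrMl//; apply: lb_le_inf => // _ [p Cp <-].
    rewrite ler_pdivrMl// (le_trans (gle _ _ Cp))//.
    exact: (svalP p).1.2.
  have gq x : g x <= q x := le_trans (gle _ x Cp0) ((svalP p0).2 x).
  exists (exist _ g (conj sg gq)) => p Cp; apply/asboolP => x; exact: gle.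
- have [sp pq] := svalP p.
  exists (f p); split => //; apply: minimal_sublinear_linear => // p' sp' p'p.
  have p'q x : p' x <= q x := le_trans (p'p x) (pq x).
  by rewrite -(pmin (exist _ p' (conj sp' p'q)))//; apply/asboolP.
Qed.

(** Separation of a concave function from a larger sublinear one, the concave
    function being given by the cone S generated by its hypograph. *)
Theorem hahn_banach_sandwich q S : sublinear q -> convex_cone S ->
  (forall u, S u -> u.2 <= q u.1) ->
  exists phi : E -> R, [/\ real_linear phi, forall x, phi x <= q x &
    forall u, S u -> u.2 <= phi u.1].
Proof.
move=> sq cS Sq.
have [phi [lphi phile]] := hahn_banach (lower_env_sublinear sq cS Sq).
exists phi; split=> // [x|u Su].
  exact: le_trans (lower_env_le_self sq cS Sq x).
have := phile (- u.1); have := lower_env_opp sq Sq Su.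
rewrite (real_linearN _ lphi); lra.
Qed.

End HahnBanach.

(** * Normals to convex sets *)

Section DualFacts.
Context {R : realType}.

Lemma dual_norm_leP (X : normedModType R) (f : dual X) (M : R) :
  (forall x, `|x| <= 1 -> `|f x| <= M) <-> `|f| <= M.
Proof.
split=> [fM|fM x x1]; last first.
  rewrite (le_trans (dual_norm_ub _ _))// (le_trans _ fM)// ler_piMr//.
  exact: (normr_ge0 f).
apply: ge_sup; first by case: (dual_has_sup f).
by move=> _ [x x1 <-]; exact: fM.
Qed.

Lemma dual_ub (X : normedModType R) (f : dual X) x : f x <= `|f| * `|x|.
Proof. exact: le_trans (ler_norm _) (dual_norm_ub f x). Qed.

Lemma dual_comp_pred (V W : normedModType R) (h : dual W) (L : V -> W) :
  linear L -> continuous L -> (h \o L : V -> R^o) \in @dual_pred R V.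
Proof.
move=> lL cL; apply/asboolP; split=> [c x y|x] /=; first by rewrite lL linearP.
by apply: continuous_comp; [exact: cL | exact: dual_continuous].
Qed.

(** The uniform boundedness principle, for sequences in the dual. *)
Lemma pointwise_bounded_dual (X : completeNormedModType R) (F : nat -> dual X) :
  (forall x, exists M, forall k, `|F k x| <= M) -> exists M, forall k, `|F k| <= M.
Proof.
move=> Fb; have [] := @Banach_Steinhauss R X R^o
    (range (fun k => dual_fun (F k))) _ _ 1.
- move=> _ [k _ <-]; split; last exact: dual_linear.
  move=> r; exists (`|F k| * r) => x xr.
  by rewrite (le_trans (dual_norm_ub _ _))// ler_wpM2l// (normr_ge0 (F k)).
- by move=> x; have [M FM] := Fb x; exists M => _ [k _ <-].
by move=> M FM; exists M => k; apply/dual_norm_leP => x; apply: FM; exists k.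
Qed.

Lemma prod_norm_ge1 (Z Y : normedModType R) (w : Z * Y) : `|w.1| <= `|w|.
Proof. by rewrite prod_normE le_max lexx. Qed.

Lemma prod_norm_ge2 (Z Y : normedModType R) (w : Z * Y) : `|w.2| <= `|w|.
Proof. by rewrite prod_normE le_max lexx orbT. Qed.

(** The uniform boundedness principle applied to each factor separately. *)
Lemma pointwise_bounded_dual_prod (Z Y : completeNormedModType R)
    (F : nat -> dual (Z * Y)%type) :
  (forall w, exists M, forall k, `|F k w| <= M) ->
  exists2 M, 0 <= M & forall k w, `|F k w| <= M * `|w|.
Proof.
move=> Fb.
pose i1 (z : Z) : Z * Y := (z, 0); pose i2 (y : Y) : Z * Y := (0, y).
have l1 : linear i1.
  by move=> c x y; apply: injective_projections; rewrite /= ?scaler0 ?addr0.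
have l2 : linear i2.
  by move=> c x y; apply: injective_projections; rewrite /= ?scaler0 ?addr0.
have c1 : continuous i1 by move=> z; apply: cvg_pair => //; exact: cvg_cst.
have c2 : continuous i2 by move=> y; apply: cvg_pair => //; exact: cvg_cst.
have [|M1 FM1] := @pointwise_bounded_dual Z
    (fun k => Dual (dual_comp_pred (F k) l1 c1)).
  by move=> z; exact: Fb.
have [|M2 FM2] := @pointwise_bounded_dual Y
    (fun k => Dual (dual_comp_pred (F k) l2 c2)).
  by move=> y; exact: Fb.
have M10 : 0 <= M1 by apply: le_trans (FM1 0).
have M20 : 0 <= M2 by apply: le_trans (FM2 0).
exists (M1 + M2) => [|k [z y]]; first exact: addr_ge0.
have zy : (z, y) = i1 z + i2 y.
  by apply: injective_projections; rewrite /= ?addr0 ?add0r.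
rewrite {1}zy linearD (le_trans (ler_normD _ _))// mulrDl.
apply: lerD.
  apply: le_trans (dual_norm_ub (Dual (dual_comp_pred (F k) l1 c1)) z) _.
  apply: ler_pM; [exact: (normr_ge0 (Dual _)) | exact: normr_ge0 | exact: FM1 |].
  exact: (prod_norm_ge1 (z, y)).
apply: le_trans (dual_norm_ub (Dual (dual_comp_pred (F k) l2 c2)) y) _.
apply: ler_pM; [exact: (normr_ge0 (Dual _)) | exact: normr_ge0 | exact: FM2 |].
exact: (prod_norm_ge2 (z, y)).
Qed.

End DualFacts.

Section ConvexNormals.
Context {R : realType}.

(** Convexity, in the form that follows a segment from a base point. *)
Definition segment_closed (W : lmodType R) (O : set W) : Prop :=
  forall u v, O u -> O v -> forall t : R, 0 <= t <= 1 -> O (u + t *: (v - u)).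

(** The quotient defining epsilon-normals is constant along the segment from w
    to v, so that the bound on its upper limit at w holds globally. *)
Lemma eps_normal_le (W : normedModType R) (O : set W) (e : R) w f v :
  segment_closed O -> eps_normal O e w f -> O v -> f (v - w) <= e * `|v - w|.
Proof.
move=> cO [Ow fe] Ov.
have [->|vw] := eqVneq v w; first by rewrite subrr linear0 normr0 mulr0.
have n0 : 0 < `|v - w| by rewrite normr_gt0 subr_eq0.
rewrite -ler_pdivrMr// -lee_fin (le_trans _ fe)//.
apply: le_ereal_inf_tmp => _ [V FV <-]; apply: le_ereal_sup_tmp.
move: FV => /nbhs_normP[d /= d0 dV].
pose t := Num.min 1 (d / 2 / `|v - w|).
have t0 : 0 < t by rewrite lt_min ltr01/= !divr_gt0.
have t1 : t <= 1 by rewrite ge_min lexx.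
have wt : w + t *: (v - w) - w = t *: (v - w) by rewrite addrC addKr.
have nt : `|t *: (v - w)| = t * `|v - w| by rewrite normrZ gtr0_norm.
exists (f (w + t *: (v - w) - w) / `|w + t *: (v - w) - w|)%:E.
  exists (w + t *: (v - w)) => //; apply: dV.
  - rewrite /= opprD addNKr normrN nt -ltr_pdivlMr//.
    rewrite gt_min; apply/orP; right; rewrite ltr_pM2r ?invr_gt0//.
    by rewrite ltr_pdivrMr// ltr_pMr// ltr1n.
  - rewrite /= -subr_eq0 wt scaler_eq0 negb_or gt_eqF//= subr_eq0//.
  - by apply: cO => //; rewrite ltW.
rewrite wt nt linearZ lee_fin /= -[_ *: _]/(t * f (v - w)) -mulf_div.
by rewrite divff ?mul1r// gt_eqF.
Qed.

(** Passing to the limit in f_k (v - w_k) <= e_k |v - w_k| requires f_k (w_k - w)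
    to vanish: the f_k converge only weakly*, but they are bounded by the
    uniform boundedness principle. *)
Lemma limiting_normal_convex (Z Y : completeNormedModType R) (O : set (Z * Y))
    w f v :
  segment_closed O -> limiting_normal O w f -> O v -> f (v - w) <= 0.
Proof.
move=> cO [Ow [e [ws [fs [[e0 eto] wsto fsto fsN]]]]] Ov.
have fsx x : (fun k => fs k x) @ \oo --> f x.
  have fsto' : fs @ \oo --> (f : weak_star _) by exact: fsto.
  exact: (weak_star_cvgP _ _).1 fsto' x.
have [x|M M0 fsM] := @pointwise_bounded_dual_prod _ Z Y fs.
  have : cvgn (fun k => fs k x) by apply/cvg_ex; exists (f x); exact: fsx.
  by move=> /cvg_seq_bounded/pinfty_ex_gt0[M _ fM]; exists M => k; exact: fM.
have dto : (fun k => `|v - ws k|) @ \oo --> `|v - w|.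
  by apply: cvg_norm; apply: cvgB => //; exact: cvg_cst.
have d0to : (fun k => `|ws k - w|) @ \oo --> (0 : R).
  rewrite -(@normr0 _ (Z * Y)%type) -(subrr w).
  by apply: cvg_norm; apply: cvgB => //; exact: cvg_cst.
have rto : (fun k => e k * `|v - ws k| + M * `|ws k - w|) @ \oo --> (0 : R).
  have Mto : (fun k => M * `|ws k - w|) @ \oo --> M * 0 by exact: cvgMl_tmp.
  by have := cvgD (cvgM eto dto) Mto; rewrite mul0r mulr0 addr0; apply.
apply: (ler_cvg_to (fsx (v - w)) rto); near=> k.
rewrite -(subrKA (ws k)) linearD; apply: lerD.
  exact: (eps_normal_le cO (fsN k) Ov).
exact: le_trans (ler_norm _) (fsM _ _).
Unshelve. all: by end_near. Qed.

Lemma convex_limiting_normal (W : normedModType R) (O : set W) w (f : dual W) :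
  O w -> (forall v, O v -> f (v - w) <= 0) -> limiting_normal O w f.
Proof.
move=> Ow fN; split=> //; exists (fun=> 0), (fun=> w), (fun=> f); split.
- by split=> //; exact: cvg_cst.
- exact: cvg_cst.
- by apply: (@weak_star_cvgP R W (f @[_ --> \oo]) f _).2 => x; exact: cvg_cst.
move=> _; split=> //; apply: ge_ereal_inf.
exists (ereal_sup [set (f (v - w) / `|v - w|)%:E | v in O]).
  exists O => //; rewrite /within /=.
  near=> x; by [].
apply: ge_ereal_sup => _ [v Ov <-]; rewrite lee_fin.
by rewrite mulr_le0_ge0 ?invr_ge0 ?fN.
Unshelve. all: by end_near. Qed.

End ConvexNormals.

(** * Coderivative norm and Lipschitzian bound of a convex map *)

Section Toolbox.
Context {R : realType}.

Lemma sup_or_0_ub (A : set (\bar R)) x : A x -> (x <= sup_or_0 A)%E.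
Proof.
move=> Ax; rewrite /sup_or_0; case: eqP => [A0|_].
  by move: Ax; rewrite A0.
exact: ereal_sup_ubound.
Qed.

Lemma sup_or_0_le (A : set (\bar R)) M :
  (0 <= M)%E -> (forall x, A x -> (x <= M)%E) -> (sup_or_0 A <= M)%E.
Proof.
by move=> M0 AM; rewrite /sup_or_0; case: eqP => // _; exact: ge_ereal_sup.
Qed.

(** Lets n = 0, where the reciprocal is infinite, be treated together with n > 0. *)
Lemma inve_fin_le (n : R) (M : \bar R) : 0 <= n ->
  (forall k : R, 0 <= k -> k * n <= 1 -> (k%:E <= M)%E) -> ((n%:E)^-1 <= M)%E.
Proof.
rewrite le_eqVlt => /predU1P[<- kM|n0 kM].
  rewrite inve0 leye_eq; apply/eqP/eqyP => k k0.
  by rewrite kM ?mulr0// ltW.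
rewrite inver gt_eqF//; apply: kM; first by rewrite invr_ge0 ltW.
by rewrite mulVf// gt_eqF.
Qed.

Lemma le_inve_fin (n k : R) : 0 <= n -> 0 < k -> n <= k^-1 ->
  (k%:E <= (n%:E)^-1)%E.
Proof.
rewrite le_eqVlt => /predU1P[<- _ _|n0 k0 nk]; first by rewrite inve0 leey.
by rewrite inver gt_eqF// lee_fin -[k]invrK lef_pV2// posrE invr_gt0.
Qed.

Lemma bounded_linear_dual (V : normedModType R) (phi : V -> R) (K : R) : 0 <= K ->
  real_linear phi ->
  (forall x, phi x <= K * `|x|) ->
  exists2 h : dual V, (forall x, h x = phi x) & `|h| <= K.
Proof.
move=> K0 lphi phiK.
have phiB x : `|phi x| <= K * `|x|.
  by rewrite ler_norml phiK andbT lerNl -(real_linearN _ lphi) -(normrN x) phiK.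
pose phio : V -> R^o := phi.
have lin : linear phio by move=> c x y; exact: lphi.
pose L : {linear V -> R^o} := HB.pack phio (GRing.isLinear.Build _ _ _ _ _ lin).
have cont : continuous phio.
  apply: (@linear_bounded_continuous _ _ _ L).1.
  apply/bounded_funP => r; exists (K * r) => x xr.
  by rewrite (le_trans (phiB x))// ler_wpM2l.
have h : phio \in @dual_pred R V by apply/asboolP.
exists (Dual h) => //; apply/dual_norm_leP => x x1.
by rewrite (le_trans (phiB x))// ler_piMr.
Qed.

Lemma thickeningP (Y : normedModType R) (A : set Y) (r : R) (x : Y) : 0 <= r ->
  [set v + r *: b | v in A & b in [set b | `|b| <= 1]] x <->
  exists2 v, A v & `|x - v| <= r.
Proof.
move=> r0; split=> [[v Av [b /= b1 <-]]|[v Av xv]].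
  by exists v => //; rewrite addrC addKr normrZ ger0_norm// ler_piMr.
exists v => //; exists (r^-1 *: (x - v)).
  rewrite /= normrZ ger0_norm ?invr_ge0//.
  move: r0; rewrite le_eqVlt => /predU1P[<-|r0]; first by rewrite invr0 mul0r.
  by rewrite ler_pdivrMl// mulr1.
move: r0 xv; rewrite le_eqVlt => /predU1P[<-|r0 _].
  by rewrite normr_le0 subr_eq0 => /eqP->; rewrite scale0r addr0.
by rewrite scalerA divff ?gt_eqF// scale1r addrC subrK.
Qed.

Lemma linfty_norm_leP (J : Type) (p : linfty R J) (M : R) :
  0 <= M -> (forall j, `|p j| <= M) -> `|p| <= M.
Proof.
move=> M0 pM; rewrite linfty_normE.
have [->|J0] := eqVneq (range (fun j => `|p j|)) set0; first by rewrite sup0.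
by apply: ge_sup; [exact/set0P | move=> _ [j _ <-]].
Qed.

(** If (f, -g) is normal at (z, y), moving z by a small e x allows y to follow
    at a distance at most l e |x|, and normality bounds f (e x) by the variation
    of g over that distance. *)
Lemma coderivative_norm_le_lip (Z Y : completeNormedModType R)
    (F : Z -> set Y) z y : segment_closed (graph F) -> F z y ->
  (coderivative_norm F z y <= lip F z y)%E.
Proof.
move=> cF Fzy; apply: le_ereal_inf_tmp => _ [l [l0 [U [V [Uz Vy UV]]]] <-].
apply: sup_or_0_le; first by rewrite lee_fin.
move=> _ [f [g /= g1 fN] <-]; rewrite lee_fin.
have fg z' y' : F z' y' -> f (z' - z) - g (y' - y) <= 0.
  move=> Fzy'; exact: (limiting_normal_convex cF fN (v := (z', y'))).
have /nbhs_ballP[d /= d0 dU] := Uz.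
have fle x : `|x| <= 1 -> f x <= l.
  move=> x1; pose e := d / 2; have e0 : 0 < e by rewrite divr_gt0.
  have nx : `|z - (z + e *: x)| <= e.
    by rewrite opprD addNKr normrN normrZ gtr0_norm// ler_piMr// ltW.
  have Uz' : U (z + e *: x).
    apply: dU; rewrite -ball_normE /=; apply: le_lt_trans nx _.
    by rewrite /e ltr_pdivrMr// ltr_pMr// ltr1n.
  have /(thickeningP _ _) := UV _ _ (nbhs_singleton Uz) Uz' y
    (conj Fzy (nbhs_singleton Vy)).
  move=> /(_ _)[|y' Fy' yy']; first exact: mulr_ge0.
  have fex : f (e *: x) = e * f x by rewrite linearZ.
  have := fg _ _ Fy'; rewrite [z + _]addrC addrK fex.
  have : g (y' - y) <= l * e.
    rewrite (le_trans (dual_ub _ _))//.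
    rewrite (le_trans (ler_piMl _ g1))// distrC (le_trans yy')//.
    by rewrite ler_wpM2l.
  by move=> gle fgle; rewrite -(ler_pM2l e0) [e * l]mulrC; lra.
apply/dual_norm_leP => x x1; rewrite ler_norml fle// andbT lerNl -linearN.
by rewrite fle// normrN.
Qed.

End Toolbox.

(** * Convex hulls and weak* closures *)

Section Hull.
Context {R : realType}.

Lemma sub_conv_hull (V : lmodType R) (A : set V) : A `<=` conv_hull A.
Proof.
move=> v Av; exists 1%N, (fun=> 1), (fun=> v); split=> //.
  by rewrite big_ord1.
by rewrite big_ord1 scale1r.
Qed.

Lemma conv_hull_le (V : lmodType R) (A : set V) (f : V -> R^o) (M : R) :
  linear f -> (forall v, A v -> f v <= M) -> forall v, conv_hull A v -> f v <= M.
Proof.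
move=> lf AM _ [n [l [w [l0 l1 Aw ->]]]].
pose L : {linear V -> R^o} := HB.pack f (GRing.isLinear.Build _ _ _ _ _ lf).
rewrite -[f _]/(L _) linear_sum -[M]mul1r -l1 mulr_suml.
apply: ler_sum => i _; rewrite linearZ; apply: ler_wpM2l => //; exact: AM.
Qed.

(** The cone generated by a convex hull is closed under addition. *)
Lemma conv_hull_cone (V : lmodType R) (A : set V) u v (k l : R) :
  conv_hull A u -> conv_hull A v -> 0 <= k -> 0 <= l ->
  exists2 w, conv_hull A w & (k + l) *: w = k *: u + l *: v.
Proof.
move=> Au Av k0 l0.
have := addr_ge0 k0 l0; rewrite le_eqVlt => /predU1P[kl0|kl0].
  exists u => //; have [-> ->] : k = 0 /\ l = 0 by lra.
  by rewrite addr0 !scale0r addr0.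
have [n [c [w [c0 c1 Aw ->]]]] := Au; have [m [d [z [d0 d1 Az ->]]]] := Av.
exists ((k + l)^-1 *: (k *: (\sum_i c i *: w i) + l *: (\sum_i d i *: z i)));
  last by rewrite scalerA divff ?scale1r// gt_eqF.
exists (n + m)%N, (fun i => match fintype.split i with
  inl i => (k + l)^-1 * (k * c i) | inr j => (k + l)^-1 * (l * d j) end),
  (fun i => match fintype.split i with inl i => w i | inr j => z j end); split.
- by move=> i; case: fintype.split => j; rewrite !mulr_ge0// invr_ge0 ltW.
- rewrite big_split_ord /=.
  under eq_bigr => i _ do rewrite (unsplitK (inl i)).
  under [X in _ + X]eq_bigr => i _ do rewrite (unsplitK (inr i)).
  by rewrite -!mulr_sumr c1 d1 !mulr1 -mulrDr mulVf// gt_eqF.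
- by move=> i; case: fintype.split.
- rewrite big_split_ord /=.
  under [X in _ = X + _]eq_bigr => i _ do rewrite (unsplitK (inl i)) -!scalerA.
  under [X in _ = _ + X]eq_bigr => i _ do rewrite (unsplitK (inr i)) -!scalerA.
  by rewrite -!scaler_sumr -scalerDr.
Qed.

(** The linear function that measures by how much x violates the inequality
    encoded by a pair (v, alpha). *)
Lemma linear_eval_sub (X : normedModType R) (x : X) :
  linear (fun z : dual X * R^o => z.1 x - z.2 : R^o).
Proof.
move=> c u v /=.
suff : c * u.1 x + v.1 x - (c * u.2 + v.2) = c * (u.1 x - u.2) + (v.1 x - v.2).
  by [].
ring.
Qed.

(** Evaluation at x is weak* continuous, so a linear inequality tested at x
    extends to the closure. *)
Lemma weak_star_closure_le (X : normedModType R) (A : set (dual X * R^o))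
    (w : dual X * R^o) x (M : R) :
  weak_star_closure A w -> (forall z, A z -> z.1 x - z.2 <= M) ->
  w.1 x - w.2 <= M.
Proof.
rewrite /weak_star_closure closureEcvg => -[G PG [Gw AG]] AM.
have Gx : (fun z : dual X * R^o => z.1 x : R^o) @ G --> (w.1 x : R^o).
  pose p1 (z : weak_star X * R^o) : weak_star X := z.1.
  have G1 : p1 @ G --> (w.1 : weak_star X).
    by apply: cvg_trans (cvg_app p1 Gw) _; exact: cvg_fst.
  exact: (weak_star_cvgP _ _).1 G1 x.
have G2 : (fun z : dual X * R^o => z.2 : R^o) @ G --> (w.2 : R^o).
  pose p2 (z : weak_star X * R^o) : R^o := z.2.
  by apply: cvg_trans (cvg_app p2 Gw) _; exact: cvg_snd.
apply: (cvgr_to_le (cvgB Gx G2)).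
by apply: AG => z /AM.
Qed.

End Hull.

(** * The slope supremum and the coderivative of the scalar map *)

Section Graphs.
Context {R : realType} {X : normedModType R} {T : Type}.
Variables (a : T -> dual X) (b : T -> R).

Lemma feasible_graph_convex (I : Type) (B : I -> set T) :
  segment_closed (graph (feasible a b B)).
Proof.
move=> [p x] [q y] /= px qy s /andP[s0 s1] j t Bjt.
have := px j t Bjt; have := qy j t Bjt => /= yt xt.
suff : a t (x + s *: (y - x)) <= b t + (p j + s * (q j - p j)) by [].
have -> : a t (x + s *: (y - x)) = a t x + s * (a t y - a t x).
  by rewrite linearD linearZ linearB.
nra.
Qed.

Lemma feasible_min_graph_convex : segment_closed (graph (feasible_min a b)).
Proof.
move=> [p x] [q y] /= px qy s /andP[s0 s1] t.
have := px t; have := qy t => /= yt xt.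
suff : a t (x + s *: (y - x)) <= b t + (p + s * (q - p)) by [].
have -> : a t (x + s *: (y - x)) = a t x + s * (a t y - a t x).
  by rewrite linearD linearZ linearB.
nra.
Qed.

End Graphs.

Section MinMap.
Context {R : realType} {X : completeNormedModType R} {T : Type}.
Variables (a : T -> dual X) (b : T -> R).

Lemma C0_le x (M : R) : (forall t, a t x - b t <= M) ->
  forall z, C0 a b z -> z.1 x - z.2 <= M.
Proof.
move=> abM; apply: (conv_hull_le (linear_eval_sub x)) => _ [t _ <-]; exact: abM.
Qed.

(** If (u, u xbar) is in the closure of C(0) and k |u| <= 1, then (-k, k u) is a
    normal that witnesses a coderivative norm of at least k. *)
Lemma slope_sup_le_coderivative_norm xbar : feasible_min a b 0 xbar ->
  (slope_sup a b xbar <= coderivative_norm (feasible_min a b) 0 xbar)%E.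
Proof.
move=> xbarF.
have norm_ge (u : dual X) (k : R) : weak_star_closure (C0 a b) (u, u xbar) ->
    0 <= k -> k * `|u| <= 1 ->
    (k%:E <= coderivative_norm (feasible_min a b) 0 xbar)%E.
  move=> cu k0 ku1.
  have [||f fE _] := @bounded_linear_dual R R^o (fun p => - (k * p)) k k0.
  - by move=> c x y; rewrite -[c *: x]/(c * x); ring.
  - by move=> x; have := ler_norm (- x); rewrite normrN; have := normr_ge0 x; nra.
  apply: (@le_trans _ _ (`|f|%:E)%E).
    rewrite lee_fin; have := dual_norm_ub f 1.
    by rewrite fE normr1 !mulr1 normrN ger0_norm.
  apply: sup_or_0_ub; exists f => //; exists (- k *: u).
    by rewrite /= normrZ normrN ger0_norm.
  apply: convex_limiting_normal => // -[p x] /= px.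
  have up : u x - u xbar <= p.
    apply: (weak_star_closure_le cu) => z; apply: C0_le => t.
    by rewrite lerBlDl; exact: px.
  suff : f (p - 0) + - (- k * u (x - xbar)) <= 0 by [].
  rewrite fE linearB subr0; nra.
apply: sup_or_0_le.
  apply: (@le_trans _ _ `|(0 : dual R^o)|%:E); first by rewrite lee_fin normr0.
  apply: sup_or_0_ub; exists 0 => //; exists 0; first by rewrite /= normr0.
  apply: convex_limiting_normal => // v _.
  by rewrite -[leLHS]/((0 : R) + - 0) oppr0 addr0.
move=> _ [u cu <-]; apply: inve_fin_le; first exact: normr_ge0.
by move=> k; exact: norm_ge.
Qed.

End MinMap.

(** * Comparison between partitions *)

Section SupFunctional.
Context {R : realType} {J : Type}.
Implicit Types p : linfty R J.

Lemma linfty_sup_ub p j : p j <= sup (range p).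
Proof.
apply: ub_le_sup; last by exists j.
exists `|p| => _ [i _ <-]; exact: le_trans (ler_norm _) (linfty_norm_ub p i).
Qed.

Lemma linfty_sup_le p (M : R) (j : J) : (forall i, p i <= M) -> sup (range p) <= M.
Proof. by move=> pM; apply: ge_sup; [exists (p j), j | move=> _ [i _ <-]]. Qed.

(** A linear function below mu * sup is mu times a mean on J: it sends 1 to mu,
    and its norm is mu. *)
Lemma sublinear_linfty_sup (mu : R) (j : J) : 0 <= mu ->
  sublinear (fun p : linfty R J => mu * sup (range p)).
Proof.
move=> mu0; split=> [p q|c p c0]; rewrite -?mulrDr 1?mulrCA ler_wpM2l//.
  apply: (linfty_sup_le j) => i.
  by rewrite -[leLHS]/(p i + q i) lerD// linfty_sup_ub.
apply: (linfty_sup_le j) => i.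
by rewrite -[leLHS]/(c * p i) ler_pM2l// linfty_sup_ub.
Qed.

Lemma linfty_cst_pred (c : R) : (fun _ : J => c : R^o) \in @linfty_pred R J.
Proof. by apply/asboolP; exists `|c|. Qed.

Definition linfty_cst (c : R) : linfty R J := Linfty (linfty_cst_pred c).

End SupFunctional.

Section BlockMaps.
Context {R : realType} {X : completeNormedModType R} {T J : Type}.
Variables (a : T -> dual X) (b : T -> R) (D : J -> set T).
Hypotheses (T_neq0 : [set: T] !=set0) (D_partition : partition [set: J] D [set: T]).

Lemma partition_index : exists ix : T -> J, forall j t, D j t <-> j = ix t.
Proof.
have [DT tD _] := D_partition.
have ex t : exists j, D j t.
  by have : [set: T] t by []; rewrite -DT => -[j _ Djt]; exists j.
have [ix Dix] := choice ex.
exists ix => j t; split=> [Djt|->//].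
by apply: tD => //; exists t.
Qed.

(** A coderivative of the scalar map is a functional - mu p with mu >= 0; one of
    the blockwise map, of at least the same norm, is obtained by replacing the
    scalar p with a suitable mean of the function p. *)
Lemma coderivative_norm_min_le xbar : feasible a b D 0 xbar ->
  (coderivative_norm (feasible_min a b) 0 xbar
    <= coderivative_norm (feasible a b D) 0 xbar)%E.
Proof.
move=> xbarF; have [ix ixP] := partition_index; have [t0 _] := T_neq0.
have slack t : 0 <= b t - a t xbar.
  have : a t xbar <= b t + 0 := xbarF (ix t) t ((ixP _ _).2 erefl).
  by rewrite addr0 subr_ge0.
apply: sup_or_0_le.
  apply: (@le_trans _ _ `|(0 : dual (linfty R J))|%:E).
    by rewrite lee_fin normr0.
  apply: sup_or_0_ub; exists 0 => //; exists 0; first by rewrite /= normr0.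
  apply: convex_limiting_normal => // v _.
  by rewrite -[leLHS]/((0 : R) + - 0) oppr0 addr0.
move=> _ [f [g /= g1 fN] <-].
have fg (p : R) x : feasible_min a b p x -> f p - g (x - xbar) <= 0.
  move=> Fpx; rewrite -[p in f p](subr0 p).
  exact: (limiting_normal_convex (@feasible_min_graph_convex _ _ _ a b) fN
    (v := ((p : R^o), x))).
pose mu := - f 1.
have fE (p : R) : f p = - (mu * p).
  have -> : f p = f (p *: (1 : R^o)) by rewrite -[p *: _]/(p * 1) mulr1.
  have -> : f (p *: (1 : R^o)) = p * f 1 by rewrite linearZ.
  rewrite /mu; ring.
have mu0 : 0 <= mu.
  have /fg : feasible_min a b 1 xbar by move=> t; have := slack t; lra.
  by rewrite subrr linear0 subr0 /mu; lra.
pose q (p : linfty R J) := mu * sup (range p).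
(* with y = s (x - xbar), these are the pairs (s p, - g y) for x feasible
   for p; written without division, they form a cone *)
pose S := [set u : linfty R J * R | exists y s, [/\ 0 < s,
  forall t, a t y <= s * (b t - a t xbar) + u.1 (ix t) & u.2 = - g y]].
have cS : convex_cone S.
  split.
  - exists 0, 1; split=> //=; last by rewrite linear0 oppr0.
    move=> t; suff : a t 0 <= 1 * (b t - a t xbar) + 0 by [].
    by rewrite linear0 mul1r addr0.
  - move=> [p c] [p' c'] [y [s [s0 ys /= ->]]] [y' [s' [s0' ys' /= ->]]].
    exists (y + y'), (s + s'); split=> /=.
    + exact: addr_gt0.
    + move=> t; have := ys t; have := ys' t => /= h' h.
      suff : a t (y + y') <=
          (s + s') * (b t - a t xbar) + (p (ix t) + p' (ix t)) by [].
      by rewrite linearD; lra.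
    + by rewrite linearD opprD.
  - move=> k [p c] k0 [y [s [s0 ys /= ->]]].
    exists (k *: y), (k * s); split=> /=.
    + exact: mulr_gt0.
    + move=> t; have := ys t => /= h.
      have -> : a t (k *: y) = k * a t y by rewrite linearZ.
      suff : k * a t y <= k * s * (b t - a t xbar) + k * p (ix t) by [].
      by rewrite -mulrA -mulrDr ler_pM2l.
    + have -> : g (k *: y) = k * g y by rewrite linearZ.
      by rewrite mulrN.
have Sq u : S u -> u.2 <= q u.1.
  case: u => p c [y [s [s0 ys /= ->]]].
  have /fg : feasible_min a b (s^-1 * sup (range p)) (xbar + s^-1 *: y).
    move=> t; have := ys t => /= h.
    have -> : a t (xbar + s^-1 *: y) = a t xbar + s^-1 * a t y.
      by rewrite linearD linearZ.
    have : s^-1 * a t y <= b t - a t xbar + s^-1 * sup (range p).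
      rewrite ler_pdivrMl// mulrDr mulVKf ?gt_eqF// (le_trans h)// lerD2l.
      exact: linfty_sup_ub.
    lra.
  rewrite [xbar + _]addrC addrK fE.
  have -> : g (s^-1 *: y) = s^-1 * g y by rewrite linearZ.
  have -> : - (mu * (s^-1 * sup (range p))) - s^-1 * g y =
      s^-1 * (- g y - mu * sup (range p)) by ring.
  by rewrite pmulr_rle0 ?invr_gt0// subr_le0.
have [phi [lphi phiq Sphi]] :=
  hahn_banach_sandwich (sublinear_linfty_sup (ix t0) mu0) cS Sq.
have [||h hE _] := @bounded_linear_dual R _ (fun p => - phi p) mu mu0.
- by move=> c x y; rewrite lphi; ring.
- move=> p; rewrite -(real_linearN _ lphi) (le_trans (phiq _))// ler_wpM2l//.
  apply: (linfty_sup_le (ix t0)) => j.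
  by rewrite -normrN (le_trans (ler_norm _))// linfty_norm_ub.
apply: (@le_trans _ _ `|h|%:E); last first.
  apply: sup_or_0_ub; exists h => //; exists g => //.
  apply: convex_limiting_normal => // -[p x] /= px.
  suff : h (p - 0) - g (x - xbar) <= 0 by [].
  suff : - g (x - xbar) <= phi p by rewrite subr0 hE; lra.
  apply: (Sphi (p, _)); exists (x - xbar), 1; split=> // t /=.
  have : a t x <= b t + p (ix t) := px (ix t) t ((ixP _ _).2 erefl).
  by rewrite linearB; lra.
rewrite lee_fin (@le_trans _ _ mu)//.
  apply/dual_norm_leP => p p1; rewrite fE normrN normrM (ger0_norm mu0).
  by rewrite ler_piMr.
(* testing on the constant -1 gives phi (-1) <= - mu, hence |h| >= mu *)
have := dual_norm_ub h (linfty_cst (-1)).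
have nc : `|linfty_cst (-1) : linfty R J| <= 1.
  by apply: linfty_norm_leP => // j; rewrite normrN1.
have : phi (linfty_cst (-1)) <= - mu.
  rewrite (le_trans (phiq _))// -(mulrN1 mu) ler_wpM2l//.
  by apply: (linfty_sup_le (ix t0)).
rewrite hE => phile hub.
rewrite (@le_trans _ _ (- phi (linfty_cst (-1))))//; first lra.
rewrite (le_trans (ler_norm _))// (le_trans hub)// ler_piMr//.
exact: (normr_ge0 h).
Qed.

(** Repeating p_j along the block T_j does not increase distances. *)
Lemma lip_block_le xbar :
  (lip (feasible a b D) 0 xbar <= lip (feasible_max a b) 0 xbar)%E.
Proof.
have [ix ixP] := partition_index.
have pullP (p : linfty R J) : (p \o ix : T -> R^o) \in @linfty_pred R T.
  by apply/asboolP; exists `|p| => t; exact: linfty_norm_ub.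
pose pull p : linfty R T := Linfty (pullP p).
have pullB p q : `|pull p - pull q| <= `|p - q|.
  by apply: linfty_norm_leP => // t; exact: (linfty_norm_ub (p - q)).
have FE p x : feasible a b D p x <-> feasible_max a b (pull p) x.
  split=> Fx; first by move=> i t <-; apply: Fx; exact/ixP.
  by move=> j t /ixP ->; exact: (Fx t).
have pull0 : pull 0 = 0 by apply/val_inj/funext.
apply: le_ereal_inf => _ [l [l0 [U [V [U0 Vx UV]]]] <-]; exists l => //; split=> //.
have /nbhs_ballP[d /= d0 dU] := U0.
exists (ball 0 d), V; split=> //; first exact: nbhsx_ballx.
have inU p : ball 0 d p -> U (pull p).
  rewrite -ball_normE /= => pd; apply: dU; rewrite -ball_normE /=.
  by rewrite -pull0; exact: le_lt_trans (pullB _ _) pd.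
move=> p q /inU Up /inU Uq x [/FE px Vx'].
have /thickeningP := UV _ _ Up Uq x (conj px Vx').
move=> /(_ (mulr_ge0 l0 (normr_ge0 _)))[y /FE qy xy].
apply/thickeningP; first exact: mulr_ge0.
by exists y => //; rewrite (le_trans xy)// ler_wpM2l.
Qed.

End BlockMaps.

(** * The Lipschitzian bound of the map with independent perturbations *)

Section Certificate.
Context {R : realType}.

Lemma row_coord_le_norm m (e : 'rV[R]_m) i : `|e 0 i| <= `|e|.
Proof. by rewrite [leRHS]mx_normrE (le_bigmax _ _ (0, i)). Qed.

Lemma row_norm_le m (e : 'rV[R]_m) (M : R) :
  0 <= M -> (forall i, `|e 0 i| <= M) -> `|e| <= M.
Proof.
move=> M0 eM; rewrite [leLHS]mx_normrE; apply: bigmax_le => // -[i j] _.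
by rewrite ord1 /=; exact: eM.
Qed.

(** A theorem of the alternative: if the ball of radius r around x contains no
    solution of the system A, a convex combination of its inequalities is
    violated at x by more than r times its largest absolute value on the y_i.
    Otherwise the sandwich theorem, applied in R^m to the images of the
    inequalities under evaluation at the y_i and to r times the max norm, gives
    coefficients c_i with sum of |c_i| at most r, and x minus the combination of
    the y_i with these coefficients is a solution within r of x. *)
Lemma infeasibility_certificate (X : normedModType R) (A : set (dual X * R^o))
    (x : X) (r : R) m (y : 'I_m -> X) :
  A !=set0 -> 0 <= r -> (forall i, `|y i| <= 1) ->
  (forall w, `|x - w| <= r -> ~ forall z, A z -> z.1 w <= z.2) ->
  exists2 z, conv_hull A z & forall i, r * `|z.1 (y i)| < z.1 x - z.2.
Proof.
move=> [z0 Az0] r0 y1 infeas; apply: contrapT => nocert.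
pose th (z : dual X * R^o) : 'rV[R]_m := \row_i z.1 (y i).
pose ga (z : dual X * R^o) : R := z.1 x - z.2.
have thE (c d : R) z z' : th (c *: z + d *: z') = c *: th z + d *: th z'.
  by apply/rowP => i; rewrite !mxE.
pose Lga : {linear (dual X * R^o)%type -> R^o} :=
  HB.pack (fun z : dual X * R^o => z.1 x - z.2 : R^o)
    (GRing.isLinear.Build _ _ _ _ _ (linear_eval_sub x)).
have gaE (c d : R) z z' : ga (c *: z + d *: z') = c * ga z + d * ga z'.
  by rewrite -[ga _]/(Lga _) linearD !linearZ.
have thZ (c : R) z : th (c *: z) = c *: th z.
  by have := thE c 0 z z; rewrite !scale0r !addr0.
have gaZ (c : R) z : ga (c *: z) = c * ga z.
  by have := gaE c 0 z z; rewrite scale0r mul0r !addr0.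
pose S := [set u : 'rV[R]_m * R | exists k z,
  [/\ 0 <= k, conv_hull A z & u = (k *: th z, k * ga z)]].
have cS : convex_cone S.
  split.
  - exists 0, z0; split=> //; first exact: sub_conv_hull.
    by rewrite scale0r mul0r.
  - move=> _ _ [k [z [k0 Az ->]]] [l [z' [l0 Az' ->]]] /=.
    have [w Aw wE] := conv_hull_cone Az Az' k0 l0.
    exists (k + l), w; split=> //; first exact: addr_ge0.
    have tw : (k + l) *: th w = k *: th z + l *: th z' by rewrite -thZ wE thE.
    have gw : (k + l) * ga w = k * ga z + l * ga z' by rewrite -gaZ wE gaE.
    by rewrite tw gw.
  - move=> c _ c0 [k [z [k0 Az ->]]] /=; exists (c * k), z; split=> //.
      by rewrite mulr_ge0// ltW.
    by rewrite scalerA mulrA.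
pose q (e : 'rV[R]_m) := r * `|e|.
have sq : sublinear q.
  split=> [e e'|c e c0]; rewrite /q; first by rewrite -mulrDr ler_wpM2l// ler_normD.
  by rewrite normrZ gtr0_norm// mulrCA.
have Sq u : S u -> u.2 <= q u.1.
  move=> [k [z [k0 Az ->]]] /=; rewrite /q normrZ ger0_norm// mulrCA ler_wpM2l//.
  have [i zi] : exists i, ga z <= r * `|z.1 (y i)|.
    apply: contrapT => noi; apply: nocert; exists z => // i.
    by rewrite ltNge; apply/negP => zi; apply: noi; exists i.
  rewrite (le_trans zi)// ler_wpM2l//.
  by have := row_coord_le_norm (th z) i; rewrite mxE.
have [phi [lphi phiq Sphi]] := hahn_banach_sandwich sq cS Sq.
pose phio : 'rV[R]_m -> R^o := phi.
have lin : linear phio by move=> c u v; exact: lphi.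
pose L : {linear 'rV[R]_m -> R^o} := HB.pack phio (GRing.isLinear.Build _ _ _ _ _ lin).
pose c i := phi (delta_mx 0 i).
have phiE e : phi e = \sum_i e 0 i * c i.
  rewrite {1}(row_sum_delta e) -[phi _]/(L _) linear_sum.
  by apply: eq_bigr => i _; rewrite linearZ.
(* the vector of signs has max norm at most 1 *)
have c_le : \sum_i `|c i| <= r.
  have <- : phi (\row_i Num.sg (c i)) = \sum_i `|c i|.
    by rewrite phiE; apply: eq_bigr => i _; rewrite mxE normrEsg.
  rewrite (le_trans (phiq _))// ler_piMr//; apply: row_norm_le => // i.
  by rewrite mxE normr_sg lern1 leq_b1.
apply: (infeas (x - \sum_i c i *: y i)).
  rewrite subKr (le_trans (ler_norm_sum _ _ _))// (le_trans _ c_le)//.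
  by apply: ler_sum => i _; rewrite normrZ ler_piMr.
move=> z Az.
have : ga z <= phi (th z).
  apply: (Sphi (th z, ga z)); exists 1, z; split=> //; first exact: sub_conv_hull.
  by rewrite scale1r mul1r.
rewrite phiE linearB linear_sum /ga.
have -> : \sum_i th z 0 i * c i = \sum_i z.1 (c i *: y i).
  by apply: eq_bigr => i _; rewrite mxE linearZ mulrC.
lra.
Qed.

End Certificate.

Section Cluster.
Context {R : realType}.

Lemma fmap_ultra (S T : Type) (f : S -> T) (F : set_system S) :
  UltraFilter F -> UltraFilter (f @ F).
Proof.
move=> FU; split=> [|G PG FG]; first exact: fmap_proper_filter.
apply/seteqP; split=> [A GA|]; last exact: FG.
have [//|FnA] := in_ultra_setVsetC (f @^-1` A) FU.
have GnA : G (~` A) by exact: FG.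
by have [x []] := filter_ex (filterI GA GnA).
Qed.

(** A form of the Banach-Alaoglu theorem: the norm bound is asked of members of
    A only on finitely many vectors at a time.  The sets of members meeting one
    such finite requirement form a filter base; along a finer ultrafilter every
    evaluation converges, and the pointwise limit is a functional bounded by
    K. *)
Lemma weak_star_cluster (X : normedModType R) (A : set (dual X * R^o)) (K : R)
    (x0 : X) : 0 <= K ->
  (forall (e : R) (Y : seq X), 0 < e -> {in Y, forall y, `|y| <= 1} ->
    exists z, [/\ A z, {in Y, forall y, `|z.1 y| <= K} & `|z.2 - z.1 x0| <= e]) ->
  exists2 v : dual X, `|v| <= K & weak_star_closure A (v, v x0).
Proof.
move=> K0 AK.
pose D := [set i : R * seq X | 0 < i.1 /\ {in i.2, forall y, `|y| <= 1}].
pose B (i : R * seq X) := [set z : dual X * R^o |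
  [/\ A z, {in i.2, forall y, `|z.1 y| <= K} & `|z.2 - z.1 x0| <= i.1]].
have PF : ProperFilter (filter_from D B).
  apply: filter_from_proper; last by move=> [e Y] [/= e0 Y1]; exact: AK.
  apply: filter_from_filter; first by exists (1, [::]).
  move=> [e Y] [e' Y'] [/= e0 Y1] [/= e0' Y1']; exists (Num.min e e', Y ++ Y').
    split=> /=; first by rewrite lt_min e0.
    by move=> y; rewrite mem_cat => /orP[/Y1|/Y1'].
  move=> z [/= Az zY ze]; split; split=> //=.
  - by move=> y Yy; apply: zY; rewrite mem_cat Yy.
  - by rewrite (le_trans ze)// ge_min lexx.
  - by move=> y Yy; apply: zY; rewrite mem_cat Yy orbT.
  - by rewrite (le_trans ze)// ge_min lexx orbT.
have [G [GU FG]] := ultraFilterLemma PF.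
have GP : ProperFilter G by exact: ultra_proper.
have GA : G A by apply: FG; exists (1, [::]) => // z [].
have G1 y : `|y| <= 1 -> G [set z : dual X * R^o | `|z.1 y| <= K].
  move=> y1; apply: FG; exists (1, [:: y]).
    by split=> // u; rewrite inE => /eqP->.
  by move=> z [_ zY _]; apply: zY; rewrite inE.
pose ev y (z : dual X * R^o) : R^o := z.1 y.
have Gle y : G [set z | `|ev y z| <= K * `|y|].
  have [->|y0] := eqVneq y 0.
    by apply: filterS GA => z _ /=; rewrite /ev linear0 !normr0 mulr0.
  have ny : 0 < `|y| by rewrite normr_gt0.
  have /G1 : `| `|y|^-1 *: y| <= 1.
    by rewrite normrZ normfV normr_id mulVf// gt_eqF.
  apply: filterS => z /=; rewrite linearZ [`|_ *: _|]normrM normfV normr_id.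
  by rewrite ler_pdivrMl// mulrC.
have evc y : exists l : R^o, ev y @ G --> l.
  have := @segment_compact R (- (K * `|y|)) (K * `|y|).
  rewrite compact_ultra => /(_ (ev y @ G) (fmap_ultra (ev y) GU)).
  case; last by move=> l [_ lG]; exists l.
  apply: (@filterS _ G _ _ _ _ (Gle y)) => z zy.
  by rewrite /= in_itv /= -ler_norml.
have [phi phiG] := choice evc.
have [||v vE vK] := @bounded_linear_dual R X (phi : X -> R) K K0.
- move=> c x y.
  have evE : ev (c *: x + y) = (fun z => c * ev x z + ev y z).
    by apply/funext => z; rewrite /ev linearP.
  have l1 : ev (c *: x + y) @ G --> (c * phi x + phi y : R^o).
    rewrite evE; apply: cvgD; last exact: phiG.
    by apply: cvgMl_tmp; exact: phiG.
  exact: (cvg_unique _ (phiG _) l1).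
- move=> x; apply: (cvgr_to_le (phiG x)).
  apply: (@filterS _ G _ _ _ _ (Gle x)) => z; exact/le_trans/ler_norm.
exists v => //; rewrite /weak_star_closure closureEcvg.
exists G => //; split; last by move=> C AC; exact: filterS GA.
pose p1 (z : dual X * R^o) : weak_star X := z.1.
pose p2 (z : dual X * R^o) : R^o := z.2.
have c1 : p1 @ G --> (v : weak_star X).
  by apply: (weak_star_cvgP _ _).2 => x; rewrite vE; exact: phiG.
have c2 : p2 @ G --> (v x0 : R^o).
  have d0 : (fun z : dual X * R^o => p2 z - ev x0 z) @ G --> (0 : R^o).
    apply/cvgrPdist_le => e e0; apply: FG; exists (e, [::]) => // z [_ _ ze].
    by rewrite /= distrC subr0.
  have -> : p2 = (fun z => (p2 z - ev x0 z) + ev x0 z).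
    by apply/funext => z; rewrite subrK.
  by rewrite vE -[phi x0]add0r; apply: cvgD; [exact: d0 | exact: phiG].
apply: cvg_trans (cvg_pair c1 c2) => C GC.
by apply: (@filterS _ G _ _ _ _ GC) => -[].
Qed.

End Cluster.

Section LipBound.
Context {R : realType} {X : completeNormedModType R} {T : Type}.
Variables (a : T -> dual X) (b : T -> R).
Hypothesis T_neq0 : [set: T] !=set0.

(** Shifting the right-hand sides by u moves the elements of the hull by at most
    |u|, in their last component only. *)
Lemma conv_hull_perturb (u : linfty R T) z :
  conv_hull (range (fun t => (a t, b t + u t) : dual X * R^o)) z ->
  exists2 z', C0 a b z' & z'.1 = z.1 /\ `|z'.2 - z.2| <= `|u|.
Proof.
move=> [n [l [w [l0 l1 Aw ->]]]].
have /choice[t wE] : forall i, exists t, (a t, b t + u t) = w i.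
  by move=> i; have [t _ <-] := Aw i; exists t.
exists (\sum_i l i *: ((a (t i), b (t i)) : dual X * R^o)).
  by exists n, l, (fun i => (a (t i), b (t i))); split=> // i; exists (t i).
have fstE (w' : 'I_n -> dual X * R^o) :
    (\sum_i l i *: w' i).1 = \sum_i l i *: (w' i).1.
  by elim/big_ind2 : _ => // ? ? ? ? <- <-.
have sndE (w' : 'I_n -> dual X * R^o) :
    (\sum_i l i *: w' i).2 = \sum_i l i *: (w' i).2.
  by elim/big_ind2 : _ => // ? ? ? ? <- <-.
rewrite !fstE !sndE; split; first by apply: eq_bigr => i _; rewrite -wE.
rewrite -sumrB (le_trans (ler_norm_sum _ _ _))//.
rewrite -[leRHS]mul1r -l1 mulr_suml; apply: ler_sum => i _.
rewrite -scalerBr normrZ ger0_norm// ler_wpM2l// -wE /=.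
by rewrite opprD addrA subrr sub0r normrN linfty_norm_ub.
Qed.

(** Failure of the modulus l at arbitrarily small scales d provides the
    approximate certificates from which [weak_star_cluster] extracts v. *)
Lemma not_lipschitz_slope xbar (l : R) : 0 < l ->
  ~ lipschitz_like (feasible_max a b) 0 xbar l ->
  exists2 v : dual X, `|v| <= l^-1 & weak_star_closure (C0 a b) (v, v xbar).
Proof.
move=> l0 nlip; have l10 : 0 < l^-1 by rewrite invr_gt0.
apply: weak_star_cluster => [|e Y e0 Y1]; first exact: ltW.
(* e = d + 2 d + d / l: the shift of C(0) by u, the violation at x, and the
   variation of v between xbar and x *)
pose d := e / (3 + l^-1).
have d0 : 0 < d by rewrite divr_gt0// addr_gt0.
apply: contrapT => nocert; apply: nlip.
exists (ball 0 d), (ball xbar d); split; [exact: nbhsx_ballx..|].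
move=> p u; rewrite -!ball_normE /= !sub0r !normrN => pd ud x [px xd].
apply/thickeningP; first by rewrite mulr_ge0// ltW.
apply: contrapT => infeas; apply: nocert.
set rho := `|p - u| in infeas *.
have rho2 : rho <= 2 * d.
  by rewrite (le_trans (ler_normB _ _))//; lra.
have pt t : a t x <= b t + p t by exact: px.
pose A := range (fun t => (a t, b t + u t) : dual X * R^o).
have rho0 : 0 < rho.
  rewrite lt_neqAle normr_ge0 andbT eq_sym; apply/negP => /eqP rho0.
  apply: infeas; exists x; last by rewrite subrr normr0 rho0 mulr0.
  by move: rho0 => /eqP; rewrite normr_eq0 subr_eq0 => /eqP <-.
(* testing also in the direction of x - xbar controls v (x - xbar) *)
pose Y' := (`|x - xbar|^-1 *: (x - xbar)) :: Y.
have Y'1 (i : 'I_(size Y')) : `|Y'`_i| <= 1.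
  have : Y'`_i \in Y' by rewrite mem_nth.
  rewrite inE => /predU1P[->|/Y1//].
  rewrite normrZ normfV normr_id.
  have [->|x0] := eqVneq `|x - xbar| 0; first by rewrite mulr0.
  by rewrite mulVf.
have [|||z Az zY] := @infeasibility_certificate R X A x (l * rho) _ _ _ _ Y'1.
- by have [t _] := T_neq0; exists (a t, b t + u t), t.
- by rewrite mulr_ge0// ltW.
- move=> w xw wA; apply: infeas; exists w => //.
  by move=> s t <-; apply: (wA (a t, b t + u t)); exists t.
have zrho : z.1 x - z.2 <= rho.
  apply: (conv_hull_le (linear_eval_sub x) _ Az) => _ [t _ <-] /=.
  have : p t - u t <= rho.
    exact: le_trans (ler_norm _) (linfty_norm_ub (p - u) t).
  by have := pt t; lra.
have zY' y : y \in Y' -> `|z.1 y| <= l^-1.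
  move=> yY; have yi : (index y Y' < size Y')%N by rewrite index_mem.
  have /= := zY (Ordinal yi); rewrite nth_index// => zy.
  rewrite -(ler_pM2l l0) divff ?gt_eqF// -(ler_pM2r rho0) mul1r mulrAC.
  exact: ltW (lt_le_trans zy zrho).
have z0 : 0 <= z.1 x - z.2.
  have /ltW := zY ord0; apply: le_trans.
  by rewrite !mulr_ge0// ltW.
have zx : `|z.1 (x - xbar)| <= d * l^-1.
  have -> : x - xbar = `|x - xbar| *: (`|x - xbar|^-1 *: (x - xbar)).
    have [x0|x0] := eqVneq (x - xbar) 0; first by rewrite x0 !scaler0.
    by rewrite scalerA divff ?scale1r// normr_eq0.
  rewrite linearZ normrM normr_id ler_pM//.
    by rewrite ltW// distrC.
  by apply: zY'; rewrite inE eqxx.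
have [z' Cz' [z1 z2]] := conv_hull_perturb Az.
exists z'; split=> //; first by move=> y yY; rewrite z1 zY'// inE yY orbT.
rewrite z1.
have -> : z'.2 - z.1 xbar = (z'.2 - z.2) - (z.1 x - z.2) + z.1 (x - xbar).
  have -> : z.1 (x - xbar) = z.1 x - z.1 xbar by rewrite linearB.
  ring.
rewrite (le_trans (ler_normD _ _))//.
have : `|z'.2 - z.2 - (z.1 x - z.2)| <= d + 2 * d.
  rewrite (le_trans (ler_normB _ _))// lerD//; first by rewrite (le_trans z2)// ltW.
  by rewrite ger0_norm// (le_trans zrho).
have : d * (3 + l^-1) = e by rewrite divfK// gt_eqF// addr_gt0.
rewrite mulrDr; lra.
Qed.

Lemma lip_max_le_slope_sup xbar :
  (lip (feasible_max a b) 0 xbar <= slope_sup a b xbar)%E.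
Proof.
have s0 : (0 <= slope_sup a b xbar)%E.
  rewrite /slope_sup /sup_or_0; case: eqP => // /eqP/set0P[_ [u cu _]].
  apply: le_ereal_sup_tmp; exists (`|u|%:E^-1)%E; first by exists u.
  by rewrite inve_ge0 lee_fin.
case sE : (slope_sup a b xbar) s0 => [s| |] s0; last by [].
  apply/lee_addgt0Pr => e e0; rewrite -EFinD.
  have l0 : 0 < s + e by rewrite ltr_wpDl.
  apply: ge_ereal_inf; exists (s + e)%:E => //; exists (s + e) => //.
  split; first exact: ltW.
  apply: contrapT => /(not_lipschitz_slope l0)[v vl cv].
  have : ((s + e)%:E <= slope_sup a b xbar)%E.
    apply: (@le_trans _ _ (`|v|%:E^-1)%E); last first.
      by apply: sup_or_0_ub; exists v.
    by apply: le_inve_fin.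
  by rewrite sE lee_fin gerDl leNgt e0.
exact: leey.
Qed.

End LipBound.

Theorem theorem10 (R : realType) (X : completeNormedModType R) (T J : Type)
    (a : T -> dual X) (b : T -> R) (D : J -> set T) (xbar : X)
    (T_neq0 : [set: T] !=set0)
    (D_partition : partition [set: J] D [set: T])
    (xbar_feasible : feasible a b D 0 xbar) :
  [/\ (slope_sup a b xbar <= coderivative_norm (feasible_min a b) 0 xbar)%E,
      (coderivative_norm (feasible_min a b) 0 xbar
        <= coderivative_norm (feasible a b D) 0 xbar)%E,
      (coderivative_norm (feasible a b D) 0 xbar
        <= lip (feasible a b D) 0 xbar)%E
    & (lip (feasible a b D) 0 xbar <= lip (feasible_max a b) 0 xbar)%E] /\
  (bounded_set (range a) \/ reflexive_space X ->
   [/\ slope_sup a b xbar = coderivative_norm (feasible_min a b) 0 xbar,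
       coderivative_norm (feasible_min a b) 0 xbar
         = coderivative_norm (feasible a b D) 0 xbar,
       coderivative_norm (feasible a b D) 0 xbar
         = lip (feasible a b D) 0 xbar
     & lip (feasible a b D) 0 xbar = lip (feasible_max a b) 0 xbar]).
Proof.
have [ix ixP] := partition_index D_partition.
have xbar_min : feasible_min a b 0 xbar.
  by move=> t; exact: (xbar_feasible (ix t) t ((ixP _ _).2 erefl)).
have h1 := slope_sup_le_coderivative_norm xbar_min.
have h2 := coderivative_norm_min_le T_neq0 D_partition xbar_feasible.
have h3 := coderivative_norm_le_lip (@feasible_graph_convex _ _ _ a b _ D)
  xbar_feasible.
have h4 := lip_block_le a b D_partition xbar.
have h5 := lip_max_le_slope_sup a b T_neq0 xbar.
split=> // _; split; apply/eqP; rewrite eq_le.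
- by rewrite h1 (le_trans h2)// (le_trans h3)// (le_trans h4).
- by rewrite h2 (le_trans h3)// (le_trans h4)// (le_trans h5).
- by rewrite h3 (le_trans h4)// (le_trans h5)// (le_trans h1).
- by rewrite h4 (le_trans h5)// (le_trans h1)// (le_trans h2).
Qed.
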